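(* Let $\tau>0$. Let $D_+,D_-$ be periodic diagonal-norm first-derivative upwind SBP operators and $D$ a periodic first-derivative SBP operator, all with the same diagonal mass matrix $M$. Consider the semidiscretization $$\partial_t\mathbf u+\tfrac13\left(D\mathbf u^2+\mathbf u\,D\mathbf u\right)+D_+\mathbf w=\mathbf 0,\qquad \partial_t\mathbf v+\tfrac1\tau\left(-D\mathbf v+\mathbf w\right)=\mathbf 0,\qquad \partial_t\mathbf w+\tfrac1\tau\left(D_-\mathbf u-\mathbf v\right)=\mathbf 0$$ of the KdVH system $\partial_tu+u\,\partial_xu+\partial_xw=0$, $\tau\partial_tv=\partial_xv-w$, $\tau\partial_tw=-(\partial_xu-v)$. Then the semidiscretization conserves the discrete linear and quadratic invariants $$\mathbf 1^TM\mathbf u\approx\int u,\qquad \tfrac12\mathbf 1^TM\left(\mathbf u^2+\tau\mathbf v^2+\tau\mathbf w^2\right)\approx\tfrac12\int\left(u^2+\tau v^2+\tau w^2\right),$$ i.e. both quantities are constant in time along every solution $(\mathbf u,\mathbf v,\mathbf w)(t)$.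
   Context: All vectors are in $\mathbb R^N$ (values at the $N$ grid points), $\mathbf 1=(1,\dots,1)^T$, and nonlinear operations are pointwise: $\mathbf u^2=(u_i^2)_i$ and $\mathbf u\,D\mathbf u=(u_i(D\mathbf u)_i)_i$. A periodic first-derivative SBP (summation-by-parts) operator consists of a grid $\mathbf x$, a consistent first-derivative matrix $D\in\mathbb R^{N\times N}$, and a symmetric positive-definite matrix $M$ such that $MD+D^TM=0$. A periodic first-derivative upwind SBP operator consists of a grid $\mathbf x$, consistent first-derivative matrices $D_\pm\in\mathbb R^{N\times N}$, and a symmetric positive-definite matrix $M$ such that $MD_++D_-^TM=0$ and $\tfrac12M(D_+-D_-)$ is negative semidefinite. Consistency includes that constants are differentiated exactly: $D\mathbf 1=D_\pm\mathbf 1=\mathbf 0$. ''Diagonal-norm'' means that $M$ is diagonal. (For upwind operators, the average $D=(D_++D_-)/2$ is a periodic SBP operator with the same $M$, a typical choice of $D$.) *)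

(* Defs.v *)
From HB Require Import structures.
From mathcomp Require Import all_boot all_order all_algebra.
From mathcomp Require Import all_classical all_reals all_analysis.

Set Implicit Arguments.
Unset Strict Implicit.
Unset Printing Implicit Defensive.

Import Order.TTheory GRing.Theory Num.Theory.
Import numFieldNormedType.Exports.

Local Open Scope classical_set_scope.
Local Open Scope ring_scope.

Section Vectors.
Context {R : realType} {N : nat}.
Implicit Types (u v : 'cV[R]_N) (A : 'M[R]_N).

Definition ones : 'cV[R]_N := const_mx 1.

Definition vsqr u : 'cV[R]_N := map_mx (fun a => a ^+ 2) u.

Definition vmul u v : 'cV[R]_N := map2_mx *%R u v.

Definition quad_form A u : R := (u^T *m A *m u) 0 0.

Definition sym_pos_def A : Prop :=
  A^T = A /\ forall u, u != 0 -> 0 < quad_form A u.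

(* Symmetry is not required here: for M (D_+ - D_-) it is a consequence of
   M D_+ + D_-^T M = 0 with M symmetric. *)
Definition neg_semidef A : Prop := forall u, quad_form A u <= 0.

End Vectors.

(* Consistency of a single matrix on a fixed periodic grid is exactness on
   constants; exactness on higher powers of x is not meaningful for a periodic
   operator, and the order of accuracy only concerns families of grids.  Hence
   the grid carries no condition; its nodes may repeat, as they do at the
   element interfaces of discontinuous Galerkin operators. *)
Definition consistent_deriv (R : realType) (N : nat) (D : 'M[R]_N) : Prop :=
  D *m ones = 0.

Record periodic_sbp (R : realType) (N : nat) := PeriodicSBP {
  sbp_grid : 'cV[R]_N;
  sbp_D : 'M[R]_N;
  sbp_M : 'M[R]_N;
  sbp_consistent : consistent_deriv sbp_D;
  sbp_mass : sym_pos_def sbp_M;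
  sbp_by_parts : sbp_M *m sbp_D + sbp_D^T *m sbp_M = 0
}.

Record periodic_upwind_sbp (R : realType) (N : nat) := PeriodicUpwindSBP {
  upw_grid : 'cV[R]_N;
  upw_Dp : 'M[R]_N;
  upw_Dm : 'M[R]_N;
  upw_M : 'M[R]_N;
  upw_consistent_p : consistent_deriv upw_Dp;
  upw_consistent_m : consistent_deriv upw_Dm;
  upw_mass : sym_pos_def upw_M;
  upw_by_parts : upw_M *m upw_Dp + upw_Dm^T *m upw_M = 0;
  upw_dissipative : neg_semidef (2^-1 *: (upw_M *m (upw_Dp - upw_Dm)))
}.

Section KdVH.
Context {R : realType} {N : nat}.
Variables (tau : R) (Dp Dm D M : 'M[R]_N).

Definition kdvh_semidiscretization (u v w : R -> 'cV[R]_N) (t : R) : Prop :=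
  [/\ derive1 u t + 3^-1 *: (D *m vsqr (u t) + vmul (u t) (D *m u t))
        + Dp *m w t = 0,
      derive1 v t + tau^-1 *: (- (D *m v t) + w t) = 0 &
      derive1 w t + tau^-1 *: (Dm *m u t - v t) = 0].

(* J is an arbitrary time interval.  At an endpoint of J that belongs to J only
   continuity from inside J is required. *)
Definition kdvh_solution (J : interval R) (u v w : R -> 'cV[R]_N) : Prop :=
  [/\ {within [set` J], continuous u},
      {within [set` J], continuous v},
      {within [set` J], continuous w} &
      forall t, [set` J]° t ->
        [/\ derivable u t 1, derivable v t 1, derivable w t 1 &
            kdvh_semidiscretization u v w t]].

Definition linear_invariant (u : 'cV[R]_N) : R := (ones^T *m M *m u) 0 0.

Definition quadratic_invariant (u v w : 'cV[R]_N) : R :=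
  2^-1 * (ones^T *m M *m (vsqr u + tau *: vsqr v + tau *: vsqr w)) 0 0.

End KdVH.

Definition constant_on (R : realType) (J : interval R) (f : R -> R) : Prop :=
  forall s t, s \in J -> t \in J -> f s = f t.

(* Main.v *)
Require Import Defs.
From mathcomp Require Import all_boot all_order all_algebra.
From mathcomp Require Import all_classical all_reals all_analysis.
From mathcomp Require Import ring.
Import Order.TTheory GRing.Theory Num.Theory.
Import numFieldNormedType.Exports.
Local Open Scope classical_set_scope.
Local Open Scope ring_scope.

(* With respect to <x, y> = x^T M y, D is skew-adjoint and D_+ has adjoint -D_-,
   and pointwise multiplication is self-adjoint because M is diagonal.  Testing
   the u-equation with 1 leaves <u, D u> = 0.  Testing the three equations with
   u, tau v and tau w, the nonlinear contributions cancel,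
   <u, D u^2> + <u^2, D u> = 0, and so do <u, D_+ w> + <w, D_- u> = 0 and the
   two terms <v, w>.  Both invariants thus have zero derivative in the interior
   of J, and continuity on J extends constancy to the endpoints. *)

Section MassProduct.
Context {R : realType} {N : nat}.
Implicit Types (M A B : 'M[R]_N) (x y z : 'cV[R]_N).

Definition mass_prod M x y : R := (x^T *m M *m y) 0 0.

Lemma mass_prodE M x y :
  mass_prod M x y = \sum_j (\sum_i x i 0 * M i j) * y j 0.
Proof.
rewrite /mass_prod mxE; apply: eq_bigr => j _; rewrite mxE; congr (_ * _).
by apply: eq_bigr => i _; rewrite mxE.
Qed.

Lemma mass_prodC M x y : M^T = M -> mass_prod M x y = mass_prod M y x.
Proof.
move=> symM; rewrite /mass_prod; have -> : x^T *m M *m y = (y^T *m M *m x)^T.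
  by rewrite !trmx_mul trmxK symM mulmxA.
by rewrite mxE.
Qed.

Lemma mass_prodDr M x y z :
  mass_prod M x (y + z) = mass_prod M x y + mass_prod M x z.
Proof. by rewrite /mass_prod mulmxDr mxE. Qed.

Lemma mass_prodNr M x y : mass_prod M x (- y) = - mass_prod M x y.
Proof. by rewrite /mass_prod mulmxN mxE. Qed.

Lemma mass_prodZr M a x y : mass_prod M x (a *: y) = a * mass_prod M x y.
Proof. by rewrite /mass_prod -scalemxAr mxE. Qed.

Lemma mass_prod0r M x : mass_prod M x 0 = 0.
Proof. by rewrite /mass_prod mulmx0 mxE. Qed.

Lemma mass_prod0l M y : mass_prod M 0 y = 0.
Proof. by rewrite /mass_prod trmx0 !mul0mx mxE. Qed.

(** The hypothesis reads [M A = - B^T M]. Two matrices are allowed so that it covers both [D] paired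
    with itself and the upwind pair [Dp], [Dm]. *)
Lemma mass_prod_adjoint M A B x y : M *m A + B^T *m M = 0 ->
  mass_prod M x (A *m y) = - mass_prod M (B *m x) y.
Proof.
move=> /(canRL (addrK _)); rewrite sub0r => MA.
by rewrite /mass_prod trmx_mul mulmxA -(mulmxA _ M) MA mulmxN mulNmx mxE !mulmxA.
Qed.

Lemma vmulC x y : vmul x y = vmul y x.
Proof. by apply/matrixP => i j; rewrite !mxE mulrC. Qed.

Lemma vmul1 x : vmul ones x = x.
Proof. by apply/matrixP => i j; rewrite !mxE mul1r. Qed.

Lemma vsqrE x : vsqr x = vmul x x.
Proof. by apply/matrixP => i j; rewrite !mxE. Qed.

(** Only the terms [i = j] of the double sum survive, and there both sides are [x_j M_jj y_j z_j].
    This is where diagonality of the mass matrix enters. *)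
Lemma mass_prod_vmul M x y z : is_diag_mx M ->
  mass_prod M x (vmul y z) = mass_prod M (vmul x y) z.
Proof.
move=> /is_diag_mxP dM; rewrite !mass_prodE; apply: eq_bigr => j _.
rewrite !mxE mulrA; congr (_ * _); rewrite mulr_suml; apply: eq_bigr => i _.
rewrite mxE; have [->|/dM ->] := eqVneq i j; first by rewrite mulrAC.
by rewrite !mulr0 mul0r.
Qed.

(** Expanded in coordinates, the form is a finite sum of products with constant weights [M i j], so
    the scalar product rule applies termwise. *)
Lemma is_derive_mass_prod M (f g : R -> 'cV[R]_N) t :
  derivable f t 1 -> derivable g t 1 ->
  is_derive t 1 (fun s => mass_prod M (f s) (g s))
    (mass_prod M (derive1 f t) (g t) + mass_prod M (f t) (derive1 g t)).
Proof.
move=> df dg.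
have coord (h : R -> 'cV[R]_N) i : derivable h t 1 ->
    is_derive t 1 (fun s => h s i 0) (derive1 h t i 0).
  move=> dh; rewrite derive1E derive_mx// mxE.
  by apply: derivableP; move/derivable_mxP: dh.
under eq_fun do rewrite mass_prodE.
rewrite !mass_prodE -big_split/=.
rewrite -fct_sumE.
apply: is_derive_sum => j.
have dxM i : is_derive t 1 (fun s => f s i 0 * M i j) (derive1 f t i 0 * M i j).
  have := is_deriveM (coord f i df) (is_derive_cst (M i j) t 1).
  by move/is_derive_eq; apply; rewrite scaler0 add0r; exact: mulrC.
have := is_deriveM (is_derive_sum dxM) (coord g j dg).
rewrite fct_sumE => /is_derive_eq; apply.
by rewrite addrC; congr (_ + _); exact: mulrC.
Qed.

Lemma within_continuous_mass_prod M (A : set R) (f g : R -> 'cV[R]_N) :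
  {within A, continuous f} -> {within A, continuous g} ->
  {within A, continuous (fun s => mass_prod M (f s) (g s))}.
Proof.
move=> cf cg x.
have coord (h : R -> 'cV[R]_N) i : {within A, continuous h} ->
    {within A, continuous (fun s => h s i 0)}.
  move=> ch; apply: (within_continuous_comp _ h (fun x : 'cV[R]_N => x i 0) _ ch).
  by move=> ? _; exact: coord_continuous.
under eq_fun do rewrite mass_prodE.
apply: cvg_big => [|j _]; first exact: add_continuous.
apply: cvgM; last exact: coord.
apply: cvg_big => [|i _]; first exact: add_continuous.
apply: cvgM; [exact: coord | exact: cvg_cst].
Qed.

End MassProduct.

Lemma itvcc_subset {R : realType} (J : interval R) (a b : R) :
  a \in J -> b \in J -> `[a, b] `<=` [set` J].
Proof.
move=> aJ bJ x; rewrite /= in_itv/=.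
exact: (@interval_is_interval R J a b).
Qed.

Lemma interior_itv_subset {R : realType} (J : interval R) (a b : R) :
  a \in J -> b \in J -> `]a, b[ `<=` [set` J]°.
Proof.
move=> aJ bJ; rewrite -open_subsetE; last exact: interval_open.
by move=> x /subset_itv_oo_cc; exact: itvcc_subset.
Qed.

(** The mean value theorem on [[a, b]] uses the derivative only on the open interval, which lies in
    the interior of [J] even when [a] or [b] is an endpoint of [J]. *)
Lemma constant_on_derive0 {R : realType} (J : interval R) (f : R -> R) :
  {within [set` J], continuous f} ->
  (forall t, [set` J]° t -> is_derive t 1 f 0) -> constant_on J f.
Proof.
move=> cf df.
have le_const a b : a \in J -> b \in J -> a <= b -> f a = f b.
  move=> aJ bJ ab.
  have [||c _] := @MVT_segment R f (fun=> 0) a b ab.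
  - by move=> x xab; apply: df; exact: interior_itv_subset xab.
  - apply: continuous_subspaceW cf; exact: itvcc_subset.
  - by rewrite mul0r => /eqP; rewrite subr_eq0 => /eqP.
move=> s t sJ tJ; have [st|/ltW ts] := leP s t; first exact: le_const.
by apply/esym/le_const.
Qed.

Theorem theorem4 (R : realType) (N : nat) (tau : R)
    (opw : periodic_upwind_sbp R N) (op : periodic_sbp R N) :
  0 < tau ->
  sbp_grid op = upw_grid opw ->
  sbp_M op = upw_M opw ->
  is_diag_mx (upw_M opw) ->
  forall (J : interval R) (u v w : R -> 'cV[R]_N),
    kdvh_solution tau (upw_Dp opw) (upw_Dm opw) (sbp_D op) J u v w ->
    constant_on J (fun t => linear_invariant (upw_M opw) (u t)) /\
    constant_on J (fun t =>
      quadratic_invariant tau (upw_M opw) (u t) (v t) (w t)).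
Proof.
move=> tau_gt0 _ eqM diagM J u v w [cu cv cw sol].
set M := upw_M opw in eqM diagM *.
set D := sbp_D op in sol; set Dp := upw_Dp opw in sol; set Dm := upw_Dm opw in sol.
have [symM _] : sym_pos_def M := upw_mass opw.
have sbpD x y : mass_prod M x (D *m y) = - mass_prod M (D *m x) y.
  by apply: mass_prod_adjoint; rewrite -eqM; exact: sbp_by_parts.
have sbpU x y : mass_prod M x (Dp *m y) = - mass_prod M (Dm *m x) y.
  by apply: mass_prod_adjoint; exact: upw_by_parts.
have sbpDxx x : mass_prod M x (D *m x) = 0.
  (* Skew-adjointness and symmetry make this number its own opposite, so its double vanishes. *)
  apply/eqP; rewrite -[_ == 0](@mulrn_eq0 R _ 2) mulr2n.
  by rewrite {1}sbpD mass_prodC// addNr.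
have D1 : D *m ones = 0 by exact: sbp_consistent.
have Dm1 : Dm *m ones = 0 by exact: upw_consistent_m.
split.
- apply: constant_on_derive0.
    by apply: within_continuous_mass_prod => // x; exact: cvg_cst.
  move=> t /sol[du _ _ [eu _ _]].
  have := is_derive_mass_prod M (fun=> ones) u t (derivable_cst _ _ _) du.
  move/is_derive_eq; apply.
  rewrite derive1_cst mass_prod0l add0r.
  (* Moving [Dp] onto [ones] produces [Dm], so it is the consistency of [Dm] that removes the [w]
     term; that of [D] removes the [vsqr] term. *)
  move: eu => /(congr1 (mass_prod M ones)).
  rewrite !(mass_prodDr, mass_prodZr) mass_prod0r sbpU Dm1 mass_prod0l oppr0 addr0.
  rewrite sbpD D1 mass_prod0l oppr0 add0r mass_prod_vmul// vmul1.
  by rewrite sbpDxx mulr0 addr0.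
- pose E := fun t => 2^-1 * (mass_prod M (u t) (u t) + tau * mass_prod M (v t) (v t)
      + tau * mass_prod M (w t) (w t)).
  (* Since [M] is diagonal, pairing [ones] with [vsqr x] equals pairing [x] with itself, a form to
     which the product rule applies. *)
  have EE : (fun t => quadratic_invariant tau M (u t) (v t) (w t)) = E.
    apply/funext => t; rewrite /quadratic_invariant -/(mass_prod M _ _) /E.
    by rewrite !(mass_prodDr, mass_prodZr) !vsqrE !mass_prod_vmul// !vmul1.
  rewrite EE; apply: constant_on_derive0.
    move=> x; apply: cvgM; first exact: cvg_cst.
    apply: cvgD; [apply: cvgD; [|apply: cvgM; first exact: cvg_cst] |
      apply: cvgM; first exact: cvg_cst]; exact: within_continuous_mass_prod.
  move=> t /sol[du dv dw [eu ev ew]].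
  have Du := is_derive_mass_prod M u u t du du.
  have Dv := is_derive_mass_prod M v v t dv dv.
  have Dw := is_derive_mass_prod M w w t dw dw.
  have := is_deriveZ 2^-1
    (is_deriveD (is_deriveD Du (is_deriveZ tau Dv)) (is_deriveZ tau Dw)).
  move/is_derive_eq; apply.
  (* By symmetry of [M], the two halves of each product rule coincide, which absorbs the factor
     [2^-1]. *)
  rewrite !(mass_prodC _ (derive1 _ _))//.
  (* The two parts of the split form carry the same weight, so they cancel: one gives
     [- <D u, u^2>], the other [<u^2, D u>]. *)
  have uu : mass_prod M (u t) (derive1 u t) = mass_prod M (w t) (Dm *m u t).
    move: eu => /(congr1 (mass_prod M (u t))).
    rewrite !(mass_prodDr, mass_prodZr) mass_prod0r sbpU sbpD.
    rewrite mass_prod_vmul// -vsqrE (mass_prodC _ (D *m u t))//.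
    rewrite (mass_prodC _ (Dm *m u t))// addNr mulr0 addr0.
    exact: subr0_eq.
  have vv : tau * mass_prod M (v t) (derive1 v t) = - mass_prod M (v t) (w t).
    move: ev => /(congr1 (mass_prod M (v t))).
    rewrite !(mass_prodDr, mass_prodNr, mass_prodZr) mass_prod0r sbpDxx oppr0 add0r.
    by move/eqP; rewrite addr_eq0 => /eqP ->; rewrite mulrN mulVKf ?gt_eqF.
  have ww : tau * mass_prod M (w t) (derive1 w t) =
      mass_prod M (v t) (w t) - mass_prod M (w t) (Dm *m u t).
    move: ew => /(congr1 (mass_prod M (w t))).
    rewrite !(mass_prodDr, mass_prodNr, mass_prodZr) mass_prod0r.
    rewrite (mass_prodC _ (w t) (v t))//.
    move/eqP; rewrite addr_eq0 => /eqP ->; rewrite mulrN mulVKf ?gt_eqF//.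
    by rewrite opprB.
  (* The right-hand sides of [uu], [vv] and [ww] add up to zero. *)
  rewrite /GRing.scale/= !mulrDr uu vv ww; ring.
Qed.
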